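(* Let $Y$ be a regular space, let $Z$ be a regular completely Baire space, and let $X \subset Z$ be a Souslin-$\mathcal{F}$ set in $Z$ such that $X$ (with the subspace topology) is a perfectly paracompact space satisfying the first axiom of countability. Then a mapping $f \colon X \rightarrow Y$ is $\mathbf{\Delta}^0_2$-measurable if and only if it is piecewise continuous.
   Context: Topological terminology follows Engelking's ''General Topology''; in particular, regular spaces are $T_1$ and paracompact spaces are Hausdorff. Mappings are arbitrary functions, not assumed continuous. A set $X \subset Z$ is a Souslin-$\mathcal{F}$ set in $Z$ if it is the result of the $\mathcal{A}$-operation applied to a system of closed subsets of $Z$, i.e. there are closed sets $F_t \subset Z$ ($t \in \omega^{<\omega}$) with $X = \bigcup_{\alpha \in \omega^\omega} \bigcap_{n \in \omega} F_{\alpha|n}$. A space is perfectly paracompact if it is paracompact and each of its closed subsets is a $G_\delta$-set. A space is Baire if the intersection of countably many dense open sets in it is dense. A space is completely Baire if every closed subspace of it is Baire. $\mathbf{\Sigma}^0_2(X)$ denotes the family of $F_\sigma$-subsets of $X$, and $\mathbf{\Delta}^0_2(X)$ denotes the family of subsets of $X$ that are both $F_\sigma$ and $G_\delta$ in $X$. A mapping $f \colon X \to Y$ is $\mathbf{\Delta}^0_2$-measurable if $f^{-1}(U) \in \mathbf{\Delta}^0_2(X)$ for every open $U \subset Y$. It is piecewise continuous if $X$ can be covered by a sequence $X_0, X_1, \ldots$ of closed subsets of $X$ such that the restriction $f|X_n$ is continuous for every $n \in \omega$. *)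

(* Defs.v *)
From mathcomp Require Import all_boot.
From mathcomp Require Import all_classical.
From mathcomp Require Import topology borel_hierarchy.

Set Implicit Arguments.
Unset Strict Implicit.
Unset Printing Implicit Defensive.

Local Open Scope classical_set_scope.

Definition regular_T1 (T : topologicalType) : Prop :=
  accessible_space T /\ regular_space T.

Definition first_countable (T : topologicalType) : Prop :=
  forall x : T, exists2 B : set (set T), countable B &
    (forall V, B V -> open_nbhs x V) /\
    (forall U, open_nbhs x U -> exists2 V, B V & V `<=` U).

Definition open_cover (T : topologicalType) (U : set (set T)) : Prop :=
  U `<=` open /\ \bigcup_(A in U) A = setT.

Definition refines (T : Type) (V U : set (set T)) : Prop :=
  forall B, V B -> exists2 A, U A & B `<=` A.

Definition locally_finite (T : topologicalType) (V : set (set T)) : Prop :=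
  forall x : T, exists2 N, nbhs x N & finite_set [set B | V B /\ B `&` N !=set0].

Definition paracompact (T : topologicalType) : Prop :=
  hausdorff_space T /\
  forall U : set (set T), open_cover U ->
    exists V, [/\ open_cover V, refines V U & locally_finite V].

Definition perfectly_paracompact (T : topologicalType) : Prop :=
  paracompact T /\ forall C : set T, closed C -> Gdelta C.

Definition baire_space (T : topologicalType) : Prop :=
  forall U : nat -> set T, (forall n, open (U n) /\ dense (U n)) ->
    dense (\bigcap_n U n).

(* [set_type C] carries the subspace topology of [C]. *)
Definition completely_baire (T : topologicalType) : Prop :=
  forall C : set T, closed C -> baire_space (set_type C).

(* [mkseq a n] is the initial segment a|n = (a 0, ..., a (n - 1)). *)
Definition souslinF (T : topologicalType) (A : set T) : Prop :=
  exists2 F : seq nat -> set T, (forall t, closed (F t)) &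
    A = \bigcup_(a in [set: nat -> nat]) \bigcap_n F (mkseq a n).

Definition Delta02 (T : topologicalType) (A : set T) : Prop :=
  Fsigma A /\ Gdelta A.

Definition Delta02_measurable (T U : topologicalType) (f : T -> U) : Prop :=
  forall V : set U, open V -> Delta02 (f @^-1` V).

Definition piecewise_continuous (T U : topologicalType) (f : T -> U) : Prop :=
  exists2 C : nat -> set T, (forall n, closed (C n)) &
    \bigcup_n C n = setT /\ forall n, {within C n, continuous f}.

(* Main.v *)
(* Let I be the sigma-ideal of the subsets of X that are covered by countably
   many closed sets on each of which f is continuous. As X is perfectly
   paracompact, membership in I is a local property, whence: if A is not in I,
   there are a point x of the closure of A and an open V containing f x such
   that A minus the preimage of V is outside I in every neighbourhood of x.

   If X itself is not in I, this yields by induction a tree of points x_k of X,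
   each the limit of its children, together with open sets U_k containing f x_k
   and sets A_k outside I, shrinking along the branches and following the
   Souslin scheme of X, such that f avoids U_j, j < k, on the closure of A_k.
   That the A_i constructed earlier stay outside I near x_i after removal of the
   preimage of U_k can be arranged because each of them forbids at most one value
   of f x_k. Let U be the union of the U_k.

   Let K be the closure of {x_k} in Z. A generic point of K determines a branch
   of the tree, hence lies in X and is mapped outside U. But the preimage of U
   is a G_delta set containing all the x_k, so a generic point of K that is in X is
   also mapped into U: this contradicts the Baire property of K. *)
Require Import Defs.
From mathcomp Require Import all_boot.
From mathcomp Require Import all_classical.
From mathcomp Require Import topology borel_hierarchy.

Set Implicit Arguments.
Unset Strict Implicit.
Unset Printing Implicit Defensive.

Local Open Scope classical_set_scope.

(** * General topology: regularity, local finiteness, countable bases, subspaces *)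

Section general_topology.
Context {T : topologicalType}.
Implicit Types (A B C E N : set T) (x : T).

Lemma nbhs_regular x A : regular_space T -> nbhs x A ->
  exists B, [/\ open B, B x & closure B `<=` A].
Proof.
move=> /(_ x) /[apply] -[B Bx clBA]; exists B°; split.
- exact: open_interior.
- exact: Bx.
- by apply: subset_trans clBA; apply: closureS; exact: interior_subset.
Qed.

Lemma regular_T1_hausdorff x y : regular_T1 T -> x != y ->
  exists U V : set T, [/\ open_nbhs x U, open_nbhs y V & U `&` V = set0].
Proof.
move=> [T1 T3] /T1[A [oA /set_mem Ax /set_mem Ay]].
have [B [oB Bx clBA]] : exists B, [/\ open B, B x & closure B `<=` A].
  by apply: nbhs_regular => //; exact: open_nbhs_nbhs.
exists B, (~` closure B); split => //.
  split; first exact/closed_openC/closed_closure.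
  by move/clBA.
by rewrite -subset0 => z [Bz]; apply; exact: subset_closure.
Qed.

Lemma near_bounded_forall (P : nat -> set T) n x :
  (forall i, i < n -> nbhs x (P i)) ->
  nbhs x [set y | forall i, i < n -> P i y].
Proof.
elim: n => [_|n IHn Px]; first by apply: filterE.
have IH := IHn (fun i lin => Px i (ltnW lin)).
apply: filterS (filterI IH (Px n (ltnSn n))) => y [Py Pny] i.
by rewrite ltnS leq_eqVlt => /predU1P[-> //|/Py].
Qed.

(** Near [x] the union is finite: if [F B] meets an open [M] then so does [B], because [F B] lies in
    the closure of [B]. *)
Lemma closed_locally_finite (V : set (set T)) (F : set T -> set T) :
  locally_finite V -> (forall B, V B -> closed (F B) /\ F B `<=` closure B) ->
  closed (\bigcup_(B in V) F B).
Proof.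
move=> lfV FV x clFx.
have [N] := lfV x; rewrite nbhsE => -[M [oM Mx] MN] finN.
pose W := [set B | V B /\ B `&` M !=set0].
have finW : finite_set W.
  apply: sub_finite_set finN => B [VB [y [By My]]].
  by split=> //; exists y; split=> //; exact: MN.
have clW : closed (\bigcup_(B in W) F B).
  by apply: closed_bigcup => // B [/FV[]].
suff : closure (\bigcup_(B in W) F B) x.
  by move=> /clW[B [VB _] FBx]; exists B.
move=> O Ox; have [|y [[B VB FBy] [Oy My]]] := clFx (O `&` M).
  by apply: filterI => //; exact: open_nbhs_nbhs.
exists y; split => //; exists B => //; split => //.
by apply: ((FV B VB).2 y FBy M); exact: open_nbhs_nbhs.
Qed.

Lemma decreasing_nbhs_base x : first_countable T ->
  exists2 W : nat -> set T, (forall n, open_nbhs x (W n)) &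
    forall U, nbhs x U -> exists n, forall m, n <= m -> W m `<=` U.
Proof.
move=> /(_ x)[B cB [Bx baseB]].
have [g gP] : exists g : nat -> set T, forall V, B V -> exists n, g n = V.
  have [B0|[h]] := elimT pfcard_geP cB; first by exists (fun=> setT) => V;
    rewrite B0.
  exists h => V BV; have [n _ <-] : [set h n | n in setT] V by exact: surj.
  by exists n.
(* [g] reaches every member of [B] but may take other values; those that are not open neighbourhoods
   of [x] become [setT]. *)
pose G n := if `[< open_nbhs x (g n) >] then g n else setT.
have Gx n : open_nbhs x (G n).
  by rewrite /G; case: asboolP => // _; exact: open_nbhsT.
pose W := fix W n := if n is m.+1 then W m `&` G m else setT.
have Wx n : open_nbhs x (W n).
  by elim: n => [|n IHn] /=; [exact: open_nbhsT|exact: open_nbhsI].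
have Wle n m : n <= m -> W m `<=` W n.
  elim: m => [|m IHm]; first by case: n.
  rewrite leq_eqVlt => /predU1P[-> //|/IHm Wmn] y /= [Wy _]; exact: Wmn.
exists W => // U; rewrite nbhsE => -[O /baseB[V BV VO] OU].
have [n gn] := gP V BV; exists n.+1 => m /Wle Wm y /Wm /= [_].
by rewrite /G gn asboolT => [/VO/OU|]; last exact: Bx.
Qed.

End general_topology.

Lemma nbhs_set_val {Z : topologicalType} (X : set Z) (x : X) (U : set X) :
  nbhs x U <->
  exists2 V : set Z, open_nbhs (set_val x) V & set_val @^-1` V `<=` U.
Proof.
split.
  rewrite nbhsE => -[O [[V oV <-] Vx] OU]; exists V => //.
move=> [V [oV Vx] VU]; apply: filterS VU _.
by apply: open_nbhs_nbhs; split=> //; exists V.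
Qed.

(** * The sigma-ideal of sets covered by countably many closed pieces of continuity *)

Section piecewise_continuity.
Context {T Y : topologicalType} (f : T -> Y).
Implicit Types (A B D : set T).

(** The case [E = setT] makes [D] itself closed. In this form, gluing along a locally finite family
    involves closed sets only. *)
Definition closed_continuous D :=
  forall E, closed E -> closed (D `&` f @^-1` E).

Lemma closed_continuousE D :
  closed_continuous D <-> closed D /\ {within D, continuous f}.
Proof.
split=> [cD|[cD /continuous_closedP cf] E cE].
  split; first by rewrite -(setIT D); exact: cD closedT.
  apply/continuous_closedP => E /cD cDE; apply/closed_subspaceP.
  exists (D `&` f @^-1` E) => //.
  by rewrite (setIC D) -setIA setIid.
have /closed_subspaceP[V cV VD] := cf E cE.
by rewrite setIC -VD; exact: closedI.
Qed.

(** Membership in the sigma-ideal I; the pieces may stick out of [A]. *)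
Definition piecewise_on A :=
  exists2 D : nat -> set T, (forall n, closed_continuous (D n)) &
    A `<=` \bigcup_n D n.

Lemma piecewise_onT : piecewise_on setT <-> piecewise_continuous f.
Proof.
split=> [[D cD DT]|[C cC [CT cf]]].
  have {}cD n := (closed_continuousE (D n)).1 (cD n).
  exists D => [n|]; first by case: (cD n).
  by split=> [|n]; [rewrite -subTset|case: (cD n)].
exists C => [n|]; first exact/closed_continuousE.
by rewrite CT.
Qed.

Lemma piecewise_onS A B : A `<=` B -> piecewise_on B -> piecewise_on A.
Proof. by move=> AB [D cD BD]; exists D => // x /AB/BD. Qed.

Lemma closed_continuous0 : closed_continuous set0.
Proof. by move=> E _; rewrite set0I; exact: closed0. Qed.

Lemma piecewise_on_closed D : closed_continuous D -> piecewise_on D.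
Proof. by move=> cD; exists (fun=> D) => // x Dx; exists 0. Qed.

Lemma piecewise_on0 : piecewise_on set0.
Proof. exact: piecewise_on_closed closed_continuous0. Qed.

Lemma piecewise_on_bigcup (A : nat -> set T) :
  (forall n, piecewise_on (A n)) -> piecewise_on (\bigcup_n A n).
Proof.
move=> pA.
have /choice[D DP] : forall n, exists D : nat -> set T,
    (forall m, closed_continuous (D m)) /\ A n `<=` \bigcup_m D m.
  by move=> n; have [D] := pA n; exists D.
exists (fun k => if unpickle k is Some (n, m) then D n m else set0) => [k|].
  case: (unpickle k) => [[n m]|]; [exact: (DP n).1|exact: closed_continuous0].
move=> x [n _ /(DP n).2[m _ Dx]]; exists (pickle (n, m)) => //=.
by rewrite pickleK.
Qed.

Lemma piecewise_onU A B :
  piecewise_on A -> piecewise_on B -> piecewise_on (A `|` B).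
Proof.
move=> pA pB.
apply: (@piecewise_onS _ (\bigcup_n if n is 0 then A else B)).
  by move=> x [Ax|Bx]; [exists 0|exists 1].
by apply: piecewise_on_bigcup => -[].
Qed.

(** By countable additivity one closed piece of [B] suffices. Closedness of [H] keeps even the
    closure of the surviving set inside [B]. *)
Lemma piecewise_on_Fsigma A B : ~ piecewise_on (A `&` B) -> Fsigma B ->
  exists H, [/\ closed H, H `<=` B & ~ piecewise_on (A `&` H)].
Proof.
move=> npAB [H cH BH]; apply: contrapT => nex; apply: npAB.
rewrite BH setI_bigcupr; apply: piecewise_on_bigcup => n.
apply: contrapT => npn; apply: nex; exists (H n); split=> //.
by rewrite BH; exact: bigcup_sup.
Qed.

End piecewise_continuity.

Lemma Fsigma_setC {T : topologicalType} (A : set T) : Gdelta (~` A) -> Fsigma A.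
Proof.
move=> [F oF AF]; exists (fun n => ~` F n) => [n|]; first exact: open_closedC.
by rewrite -setC_bigcap -AF setCK.
Qed.

(** * Sets that are locally outside the ideal *)

Section large_sets.
Context {T Y : topologicalType} (f : T -> Y).
Hypotheses (Tpp : perfectly_paracompact T) (Yreg : regular_T1 Y).
Implicit Types (A B W : set T) (O U V : set Y) (x : T) (y : Y).

(** The union [G] of the open sets on which [A] is small need not be the whole space, but it is a
    countable union of closed sets [E n]. For each [n], the open sets on which the part of [A] in
    [E n] is small do cover the space, and paracompactness applies. *)
Lemma piecewise_on_local A :
  (forall x, A x -> exists2 W, nbhs x W & piecewise_on f (A `&` W)) ->
  piecewise_on f A.
Proof.
move=> locA.
pose G := \bigcup_(O in [set O | open O /\ piecewise_on f (A `&` O)]) O.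
have AG : A `<=` G.
  move=> x /[dup] Ax /locA[W]; rewrite nbhsE => -[O [oO Ox] OW] pW.
  by exists O => //; split=> //; apply: piecewise_onS pW; exact: setIS.
have [E cE GE] : Fsigma G.
  apply/Fsigma_setC/Tpp.2/open_closedC.
  by apply: bigcup_open => O [].
apply: (piecewise_onS (B := \bigcup_n (A `&` E n))).
  by rewrite -setI_bigcupr -GE => x Ax; split=> //; exact: AG.
apply: piecewise_on_bigcup => n.
pose K := [set O | open O /\ piecewise_on f (A `&` E n `&` O)].
have [|V [[oV VT] VK lfV]] := Tpp.1.2 K.
  split=> [O []//|]; rewrite -subTset => x _.
  have [Enx|Enx] := pselect (E n x).
    have [O [oO pO] Ox] : G x by rewrite GE; exists n.
    exists O => //; split=> //; apply: piecewise_onS pO => z [[]].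
    by [].
  exists (~` E n) => //; split; first exact: closed_openC.
  by rewrite -setIA setICr setI0; exact: piecewise_on0.
have /choice[D DP] : forall B, exists D : nat -> set T, V B ->
    (forall m, closed_continuous f (D m)) /\
    A `&` E n `&` B `<=` \bigcup_m D m.
  move=> B; have [VB|nVB] := pselect (V B); last by exists (fun=> set0).
  have [O [_ pO] BO] := VK B VB.
  have [D cD AD] := piecewise_onS (setIS BO) pO.
  by exists D.
(* The [m]-th pieces of all members of [V] are glued together; cutting with [closure B] makes them a
   locally finite family. *)
exists (fun m => \bigcup_(B in V) (D B m `&` closure B)) => [m C cC|x AEx].
  rewrite setI_bigcupl; apply: closed_locally_finite => // B VB.
  rewrite setIAC; split; last by move=> x [].
  by apply: closedI; [exact: (DP B VB).1|exact: closed_closure].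
have [B VB Bx] : (\bigcup_(B in V) B) x by rewrite VT.
have [m _ Dx] := (DP B VB).2 x (conj AEx Bx).
by exists m => //; exists B => //; split=> //; exact: subset_closure.
Qed.

Definition large O A x :=
  forall W, nbhs x W -> ~ piecewise_on f (A `&` W `&` ~` (f @^-1` O)).

Lemma largeS O U A B x : U `<=` O -> A `<=` B -> large O A x -> large U B x.
Proof.
move=> UO AB lA W /lA npA pB; apply: npA; apply: piecewise_onS pB.
by move=> z [[/AB Bz Wz] nOz]; do !split=> //; move=> /UO.
Qed.

(** Otherwise let [A'] be the part of [A] near whose points [A] is outside the ideal. The rest of
    [A] is in the ideal by locality, and [f] turns out to be continuous on the closure of [A'].
    Indeed, at a discontinuity there are [x] and a nearby [y] with [f x] in [V] and [f y] off the
    closure of [V]; near [y], both the part of [A] mapped outside [V] and the part mapped into it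
    are then small, although [A'] has points there. *)
Lemma large_exists A : ~ piecewise_on f A ->
  exists x, closure A x /\ exists2 V, open_nbhs (f x) V & large V A x.
Proof.
move=> npA; apply: contrapT => nex.
have small x V : closure A x -> open_nbhs (f x) V ->
    exists2 W, nbhs x W & piecewise_on f (A `&` W `&` ~` (f @^-1` V)).
  move=> Ax Vx; apply: contrapT => nW; apply: nex; exists x; split=> //.
  by exists V => // W Wx pW; apply: nW; exists W.
pose A' := [set x | A x /\ forall W, nbhs x W -> ~ piecewise_on f (A `&` W)].
have A'A : A' `<=` A by move=> x [].
have pD : piecewise_on f (A `\` A').
  apply: piecewise_on_local => x [Ax nA'x].
  apply: contrapT => nW; apply: nA'x; split=> // W Wx pW; apply: nW.
  by exists W => //; apply: piecewise_onS pW => z [[]].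
apply: npA; rewrite -(setDUK A'A).
apply: piecewise_onU => //.
apply: piecewise_onS (@subset_closure _ A') _.
apply: piecewise_on_closed => E cE x clx; split.
  by apply: closed_closure; apply: closureS clx => z [].
apply: contrapT => nEx.
have nbE : nbhs (f x) (~` E).
  by apply: open_nbhs_nbhs; split => //; exact: closed_openC.
have [V [oV Vx VE]] := nbhs_regular Yreg.2 nbE.
have clAx : closure A x.
  by apply: (closureS A'A); apply: closed_closure; apply: closureS clx => z [].
have [W Wx pW] := small x V clAx (conj oV Vx).
have [y [[clA'y Ey] Wy]] := clx W° (nbhs_interior Wx).
have nVy : open_nbhs (f y) (~` closure V).
  by split=> [|/VE//]; apply/closed_openC/closed_closure.
have [W' W'y pW'] := small y _ (closureS A'A clA'y) nVy.
have [z [[_ A'z] [W'z Wz]]] : A' `&` (W'° `&` W°) !=set0.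
  by apply: clA'y; apply: filterI; exact: nbhs_interior.
apply: (A'z (W' `&` W) (filterI W'z Wz)).
apply: piecewise_onS (piecewise_onU pW pW') => u [Au [W'u Wu]].
have [Vu|nVu] := pselect (V (f u)); last by left.
by right; do !split=> //; apply; exact: subset_closure.
Qed.

(* The values to which [f] converges at [x] along the ideal of sets that are
   small near [x]. *)
Definition limit_values O A x :=
  [set y | forall V, open_nbhs y V -> ~ large (O `|` V) A x].

(** Near [x], up to a set in the ideal, [A] outside the preimage of [O] would be mapped into two
    disjoint open sets. *)
Lemma limit_values_subset1 O A x y y' : large O A x ->
  limit_values O A x y -> limit_values O A x y' -> y = y'.
Proof.
move=> lA by_ by'; apply: contrapT => /eqP/(regular_T1_hausdorff Yreg).
move=> [V [V' [Vy V'y' VV']]].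
have small z U : limit_values O A x z -> open_nbhs z U ->
    exists2 W, nbhs x W & piecewise_on f (A `&` W `&` ~` (f @^-1` (O `|` U))).
  move=> bz Uz; apply: contrapT => nW; apply: (bz U Uz) => W Wx pW.
  by apply: nW; exists W.
have [W Wx pW] := small y V by_ Vy.
have [W' W'x pW'] := small y' V' by' V'y'.
apply: (lA _ (filterI Wx W'x)).
apply: piecewise_onS (piecewise_onU pW pW') => z [[Az [Wz W'z]] nOz].
have [Vz|nVz] := pselect (V (f z)); [right|left]; do !split=> //; case=> //.
by move=> V'z; have : (V `&` V') (f z) by []; rewrite VV'.
Qed.

Lemma large_bounded_extend n (As : nat -> set T) (xs : nat -> T) O y :
  (forall i, i < n -> ~ limit_values O (As i) (xs i) y) ->
  exists2 U, open_nbhs y U & forall i, i < n -> large (O `|` U) (As i) (xs i).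
Proof.
elim: n => [_|n IHn nlim]; first by exists setT => //; exact: open_nbhsT.
have [U Uy lU] := IHn (fun i lin => nlim i (ltnW lin)).
have /existsNP[V /not_implyP[Vy /contrapT lV]] := nlim n (ltnSn n).
exists (U `&` V) => [|i]; first exact: open_nbhsI.
rewrite ltnS leq_eqVlt => /predU1P[->|/lU]; last first.
  by apply: largeS => //; apply: setUS => z [].
by apply: largeS lV => //; apply: setUS => z [].
Qed.

Hypothesis fD : Delta02_measurable f.

Lemma Fsigma_preimage_open U : open U -> Fsigma (f @^-1` U).
Proof. by move=> /fD[]. Qed.

Lemma Fsigma_preimage_closed E : closed E -> Fsigma (f @^-1` E).
Proof.
by move=> /closed_openC/fD[_]; rewrite -preimage_setC; exact: Fsigma_setC.
Qed.

(** The fibre is a countable union of closed sets, on each of which [f] is constant. *)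
Lemma piecewise_on_preimage1 y : piecewise_on f (f @^-1` [set y]).
Proof.
have [H cH fH] :=
  Fsigma_preimage_closed (accessible_closed_set1 Yreg.1 (x := y)).
exists H => [n E cE|]; last by rewrite fH.
have Hy x : H n x -> f x = y.
  by move=> Hx; have : (\bigcup_n H n) x by [exists n]; rewrite -fH.
have [Ey|nEy] := pselect (E y).
  rewrite (_ : _ `&` _ = H n) //; apply/seteqP; split=> [x []//|x Hx].
  by split=> //=; rewrite (Hy x Hx).
rewrite (_ : _ `&` _ = set0); first exact: closed0.
by rewrite -subset0 => x [/Hy fx]; rewrite /= fx.
Qed.

(** Each [As i] forbids at most one value of [f x], so the set [C] of forbidden values is finite and
    its preimage is in the ideal. Shrinking [A] to a closed [H] off this preimage forces the new
    limit point [x] to have a permitted value. *)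
Lemma large_extend A n (As : nat -> set T) (xs : nat -> T) O :
    (forall i, i < n -> large O (As i) (xs i)) ->
    ~ piecewise_on f A -> A `<=` ~` (f @^-1` O) ->
  exists x U, [/\ closure A x, open_nbhs (f x) U,
    forall i, i < n -> large (O `|` U) (As i) (xs i) & large (O `|` U) A x].
Proof.
move=> lAs npA AO; pose B i := limit_values O (As i) (xs i).
pose C := \bigcup_(i in `I_n) B i.
have B1 i : i < n -> exists y, B i `<=` [set y].
  move=> lin; have [[y By]|] := pselect (B i !=set0).
    by exists y => y' By'; exact: limit_values_subset1 (lAs i lin) By' By.
  by move=> /nonemptyPn ->; exists (f (xs i)).
have cC : closed C.
  apply: (accessible_finite_set_closed.1 Yreg.1).
  apply: bigcup_finite => // i /B1[y By]; exact: sub_finite_set By _.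
have pC : piecewise_on f (f @^-1` C).
  rewrite /C preimage_bigcup bigcup_mkcond; apply: piecewise_on_bigcup => i.
  case: ifPn => [/set_mem /B1[y By]|_]; last exact: piecewise_on0.
  by apply: piecewise_onS (piecewise_on_preimage1 y) => x /By.
have npAC : ~ piecewise_on f (A `&` f @^-1` (~` C)).
  move=> pAC; apply: npA; apply: piecewise_onS (piecewise_onU pC pAC) => x Ax.
  by have [Cx|nCx] := pselect (C (f x)); [left|right].
have [H [cH HC npAH]] :=
  piecewise_on_Fsigma npAC (Fsigma_preimage_open (closed_openC cC)).
have [x [clx [V Vx lV]]] := large_exists npAH.
have nCx : ~ C (f x) by apply/HC/cH; apply: closureS clx => z [].
have [|U Ux lU] := @large_bounded_extend n As xs O (f x).
  by move=> i lin Bx; apply: nCx; exists i.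
exists x, (U `&` V); split.
- by apply: closureS clx => z [].
- exact: open_nbhsI.
- by move=> i /lU; apply: largeS => //; apply: setUS => z [].
(* [A] misses the preimage of [O] already, so only the removal of the preimage of [V] matters. *)
move=> W /lV npW pW; apply: npW; apply: piecewise_onS pW => z.
move=> [[[Az Hz] Wz] nVz].
by do !split=> //; move=> [/(AO _ Az)|[_ /nVz]].
Qed.

End large_sets.

(** * The tree of points and its conflict with the Baire property *)

Section souslin_tree.
Context {Y Z : topologicalType} {X : set Z} (f : X -> Y) (F : seq nat -> set Z).
Variable W : X -> nat -> set X.
Hypotheses (cF : forall t, closed (F t))
  (XF : X = \bigcup_(a in [set: nat -> nat]) \bigcap_n F (mkseq a n))
  (Wbase : forall x U, nbhs x U -> exists n, forall m, n <= m -> W x m `<=` U).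

(** Requiring a whole witnessing branch through [t], rather than membership in [F t], gives the
    decomposition [souslin_part_rcons], so that a part outside the ideal has a child that is not
    small. *)
Definition souslin_part (t : seq nat) : set X :=
  [set x | exists2 a, mkseq a (size t) = t &
                      forall n, F (mkseq a n) (set_val x)].

Lemma souslin_partT : souslin_part [::] = setT.
Proof.
rewrite -subTset => x _; have : X (set_val x) by exact: set_valP.
by rewrite {1}XF => -[a _ Fa]; exists a => // n; exact: Fa.
Qed.

Lemma souslin_part_rcons t :
  souslin_part t = \bigcup_m souslin_part (rcons t m).
Proof.
apply/seteqP; split=> x [].
  move=> a at_ Fa; exists (a (size t)) => //; exists a => //.
  by rewrite size_rcons mkseqS at_.
move=> m _ [a]; rewrite size_rcons mkseqS => /rcons_inj[at_ _] Fa.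
by exists a.
Qed.

Lemma souslin_part_sub t x : souslin_part t x -> F t (set_val x).
Proof. by move=> [a <-]; exact. Qed.

(* [node_code] locates [piece] in the Souslin scheme; its length is the depth
   of the node in the tree. *)
Record node := Node {
  node_point : X; target : set Y; piece : set X; node_code : seq nat;
  cell : set Z }.

(* Any map with [parent k < k] for [k > 0] that takes every value infinitely
   often would do. *)
Definition parent k := logn 2 k.

Lemma parent_lt k : 0 < k -> parent k < k.
Proof. exact: ltn_logl. Qed.

Lemma parent_unbounded j n : exists2 k, n <= k & 0 < k /\ parent k = j.
Proof.
have odd_gt0 : 0 < n.*2.+1 by [].
(* The odd cofactor leaves the 2-adic valuation equal to [j] and makes the product at least [n]. *)
exists (2 ^ j * n.*2.+1).
  apply: leq_trans (leq_pmull _ (expn_gt0 2 j)).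
  by rewrite -addnn; apply: leqW; exact: leq_addr.
split; first by rewrite muln_gt0 expn_gt0.
rewrite /parent lognM ?expn_gt0// pfactorK//.
by rewrite logn_coprime ?addn0// coprime2n /= odd_double.
Qed.

(** All clauses for [k] mention only nodes up to [k], which permits recursion. [tree_base] makes
    children converge to their parent. The clauses on cells let a point of [Z] lie in at most one
    cell of each depth, and keep the parent's point away from the children's cells. [tree_avoid]
    ranges over all earlier nodes, not just ancestors. *)
Record tree_node (g : nat -> node) k : Prop := {
  tree_target : open_nbhs (f (node_point (g k))) (target (g k));
  tree_cell : open_nbhs (set_val (node_point (g k))) (cell (g k));
  tree_point : closure (piece (g k)) (node_point (g k));
  tree_piece : piece (g k) `<=` souslin_part (node_code (g k));
  tree_root : k = 0 -> node_code (g k) = [::];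
  tree_base : 0 < k -> W (node_point (g (parent k))) k (node_point (g k));
  tree_pieceS : 0 < k -> piece (g k) `<=` piece (g (parent k));
  tree_avoid : forall i, i < k ->
    closure (piece (g k)) `<=` ~` (f @^-1` target (g i));
  tree_index : 0 < k ->
    exists m, node_code (g k) = rcons (node_code (g (parent k))) m;
  tree_cellS : 0 < k -> cell (g k) `<=` cell (g (parent k));
  tree_cell_parent : 0 < k ->
    ~ closure (cell (g k)) (set_val (node_point (g (parent k))));
  tree_sibling : 0 < k -> forall i, 0 < i < k -> parent i = parent k ->
    cell (g i) `&` cell (g k) = set0 }.

Variable g : nat -> node.
Hypothesis gT : forall k, tree_node g k.

Local Notation depth k := (size (node_code (g k))).

Lemma depth_parent k : 0 < k -> depth k = (depth (parent k)).+1.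
Proof. by move=> /(tree_index (gT k))[m ->]; rewrite size_rcons. Qed.

Lemma depth0 k : depth k = 0 -> k = 0.
Proof. by case: k => // k; rewrite depth_parent. Qed.

(** Cells are nested, so by induction on the depth the parents coincide; then [i] and [j] are
    siblings, whose cells are disjoint. *)
Lemma cell_inj i j z :
  cell (g i) z -> cell (g j) z -> depth i = depth j -> i = j.
Proof.
elim: (depth i) {-2}i j (erefl (depth i)) => [|n IHn] {}i j di iz jz.
  by move: di => /[dup] /depth0 -> -> /esym/depth0.
rewrite di => dj.
have i0 : 0 < i.
  by rewrite lt0n; apply/eqP => i0; rewrite i0 (tree_root (gT 0)) in di.
have j0 : 0 < j.
  by rewrite lt0n; apply/eqP => j0; rewrite j0 (tree_root (gT 0)) in dj.
have pij : parent i = parent j.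
  move: di dj; rewrite (depth_parent i0) (depth_parent j0) => -[dpi] [dpj].
  by apply: IHn => //; rewrite ?dpi//; apply: tree_cellS.
have [ij|ji|//] := ltngtP i j.
  have : (cell (g i) `&` cell (g j)) z by [].
  by rewrite (tree_sibling (gT j)) ?i0 ?ij.
have : (cell (g j) `&` cell (g i)) z by [].
by rewrite (tree_sibling (gT i)) ?j0 ?ji.
Qed.

Lemma ancestor n j : n <= depth j -> exists k,
  [/\ depth k = n, cell (g j) `<=` cell (g k) & piece (g j) `<=` piece (g k)].
Proof.
elim/ltn_ind: j => j IHj nj.
have [dj|ndj] := eqVneq (depth j) n; first by exists j; split.
have j0 : 0 < j.
  rewrite lt0n; apply: contra ndj => /eqP j0.
  by move: nj; rewrite j0 (tree_root (gT 0))// leqn0 => /eqP ->.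
have [|k [dk ck pk]] := IHj _ (parent_lt j0).
  by rewrite -ltnS -depth_parent// ltn_neqAle eq_sym ndj.
exists k; split=> //.
  exact: subset_trans (tree_cellS (gT j) j0) ck.
exact: subset_trans (tree_pieceS (gT j) j0) pk.
Qed.

(** Each node has children of arbitrarily large index, and these converge to it; so one can descend
    a level without leaving [O]. *)
Lemma point_deep j n (O : set Z) : open_nbhs (set_val (node_point (g j))) O ->
  exists2 k, n <= depth k & O (set_val (node_point (g k))).
Proof.
elim: n => [|n IHn] OO; first by exists j => //; case: OO.
have [i ni Oi] := IHn OO.
have Oi' : nbhs (node_point (g i)) (set_val @^-1` O).
  by apply/nbhs_set_val; exists O => //; split=> //; case: OO.
have [m Wm] := Wbase Oi'.
have [k mk [k0 ki]] := parent_unbounded i m.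
exists k; first by rewrite depth_parent// ki.
by apply: (Wm k mk); rewrite -ki; exact: tree_base.
Qed.

Definition level n : set Z := \bigcup_(k in [set k | depth k = n]) cell (g k).

Lemma open_level n : open (level n).
Proof. by apply: bigcup_open => k _; case: (tree_cell (gT k)). Qed.

Lemma level_limit z : closure (range (fun k => set_val (node_point (g k)))) z ->
    (forall n, level n z) ->
  exists x : X, set_val x = z /\ forall i, ~ target (g i) (f x).
Proof.
move=> clz zlev.
(* The cells around [z] single out a branch [b] of the tree. *)
have /choice[b bP] : forall n, exists k, depth k = n /\ cell (g k) z.
  by move=> n; have [k dk kz] := zlev n; exists k.
have b_gt0 n : 0 < b n.+1.
  rewrite lt0n; apply/eqP => b0; have [] := bP n.+1.
  by rewrite b0 (tree_root (gT 0)).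
have bpar n : parent (b n.+1) = b n.
  have [d1 c1] := bP n.+1; have [d0 c0] := bP n.
  apply: cell_inj (tree_cellS (gT _) (b_gt0 n) c1) c0 _.
  by apply: succn_inj; rewrite -depth_parent// d0.
have bS n : b n < b n.+1 by rewrite -bpar parent_lt.
have b_ge n : n <= b n by elim: n => // n IHn; exact: leq_ltn_trans (bS n).
have bcell n m : m <= n -> cell (g (b n)) `<=` cell (g (b m)).
  elim: n => [|n IHn]; first by rewrite leqn0 => /eqP ->.
  rewrite leq_eqVlt => /predU1P[-> //|/IHn]; apply: subset_trans.
  by rewrite -[in X in _ `<=` X]bpar; exact: tree_cellS.
(* The code grows by one entry per level, so entry [n] is the last one at level [n.+1]. *)
pose a n := last 0 (node_code (g (b n.+1))).
have ba n : node_code (g (b n)) = mkseq a n.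
  elim: n => [|n IHn]; first by apply: size0nil; exact: (bP 0).1.
  have [m bm] := tree_index (gT _) (b_gt0 n).
  by rewrite mkseqS -IHn /a bm last_rcons bpar.
(* [z] is a limit of every piece on the branch: a tree point near [z] of depth at least [n] descends
   from [b n], hence is a limit of [piece (g (b n))]. *)
have clp n (O : set Z) : open_nbhs z O ->
    exists2 x, piece (g (b n)) x & O (set_val x).
  move=> [oO Oz].
  have [|y [[j _ <-] [Oj bj]]] := clz (O `&` cell (g (b n))).
    apply: filterI; apply: open_nbhs_nbhs; split=> //.
      by case: (tree_cell (gT (b n))).
    exact: (bP n).2.
  have [nj|jn] := leqP n (depth j).
    have [k [dk ck pk]] := ancestor nj.
    have kb : k = b n.
      have [_ jj] := tree_cell (gT j).
      by apply: cell_inj (ck _ jj) bj _; rewrite dk (bP n).1.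
    have Oj' : nbhs (node_point (g j)) (set_val @^-1` O).
      by apply/nbhs_set_val; exists O.
    have [x [/pk px Ox]] := tree_point (gT j) Oj'.
    by exists x => //; rewrite -kb.
  (* A shallower node [j] would lie on the branch, with its point in the cell of its own child. *)
  exfalso; have jb : j = b (depth j).
    have [_ jj] := tree_cell (gT j).
    by apply: cell_inj jj (bcell _ _ (ltnW jn) _ bj) _; rewrite (bP _).1.
  apply: (tree_cell_parent (gT _) (b_gt0 (depth j))).
  rewrite bpar -jb; apply: subset_closure.
  exact: bcell jn _ bj.
have Xz : X z.
  rewrite XF; exists a => // n _; apply: cF => O.
  rewrite nbhsE => -[O' /(clp n)[x px Ox] O'O].
  exists (set_val x); split; last exact: O'O.
  by rewrite -ba; apply/souslin_part_sub/(tree_piece (gT _)).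
pose x : X := SigSub (mem_set Xz).
have xz : set_val x = z by [].
exists x; split=> // i.
(* The node [b i.+1] was constructed after node [i], as [i <= b i < b i.+1]. *)
apply: (tree_avoid (gT _) (leq_ltn_trans (b_ge i) (bS i))).
move=> U /nbhs_set_val[V Vx VU].
have [y py Vy] := clp i.+1 V Vx.
by exists y; split=> //; exact: VU.
Qed.

Lemma tree_absurd : completely_baire Z -> Delta02_measurable f -> False.
Proof.
move=> ZcB fD; pose O := \bigcup_k target (g k).
have oO : open O by apply: bigcup_open => k _; case: (tree_target (gT k)).
have [_ [G oG GO]] := fD O oO.
have /choice[G' G'P] : forall n, exists G', open G' /\ set_val @^-1` G' = G n.
  by move=> n; have [G' oG' GG'] := oG n; exists G'.
pose K := closure (range (fun k => set_val (node_point (g k)))).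
have KB : baire_space K by apply: ZcB; exact: closed_closure.
pose P n : set K := set_val @^-1` (G' n `&` level n).
have PP n : open (P n) /\ dense (P n).
  split.
    exists (G' n `&` level n) => //.
    by apply: openI; [exact: (G'P n).1|exact: open_level].
  move=> _ /[swap] -[Q oQ <-] [z Qz].
  have clz : K (set_val z) by exact: set_valP.
  (* Density: [Q] contains a tree point, hence one of depth at least [n]. Its ancestor of depth [n]
     puts it in [level n], and its own target puts it in [G' n]. *)
  have [|_ [[j _ <-] Qj]] := clz Q; first exact: open_nbhs_nbhs.
  have [k nk Qk] := point_deep n (conj oQ Qj).
  have Kk : K (set_val (node_point (g k))) by apply: subset_closure; exists k.
  exists (SigSub (mem_set Kk)); split=> //; split.
    have : (f @^-1` O) (node_point (g k)).
      by exists k => //; case: (tree_target (gT k)).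
    by rewrite GO => /(_ n I); rewrite -(G'P n).2.
  have [i [di ki _]] := ancestor nk; exists i => //.
  by apply: ki; case: (tree_cell (gT k)).
have K0 : K (set_val (node_point (g 0))) by apply: subset_closure; exists 0.
have [|z [_ Pz]] := KB P PP setT _ openT.
  by exists (SigSub (mem_set K0)).
have [|n|x [xz nOx]] := @level_limit (set_val z).
- exact: set_valP.
- by case: (Pz n I).
have : (f @^-1` O) x.
  rewrite GO => n _; rewrite -(G'P n).2 /= xz; by case: (Pz n I).
by case=> k _ /nOx.
Qed.

End souslin_tree.

(** * Recursive construction of the tree *)

Lemma sequential_choice (T : Type) (P : nat -> (nat -> T) -> Prop)
    (g0 : nat -> T) :
    (forall k g h, (forall i, i < k -> g i = h i) -> P k g -> P k h) ->
    P 0 g0 ->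
    (forall k g, P k g ->
      exists x, P k.+1 (fun i => if i < k then g i else x)) ->
  exists g, forall k, P k g.
Proof.
move=> Pext P0 Pnext.
have /choice[next nextP] : forall kg : nat * (nat -> T), exists x,
    P kg.1 kg.2 -> P kg.1.+1 (fun i => if i < kg.1 then kg.2 i else x).
  move=> [k g] /=; have [/Pnext[x Px]|nP] := pselect (P k g); first by exists x.
  by exists (g0 0).
pose G := fix G k := if k is k'.+1
  then fun i => if i < k' then G k' i else next (k', G k') else g0.
have GP k : P k (G k) by elim: k => //= k /(nextP (k, G k)).
have Gstable i k : i < k -> G k i = G i.+1 i.
  elim: k => // k IHk; rewrite ltnS leq_eqVlt => /predU1P[-> //|ik].
  by rewrite [LHS]/= ik IHk.
(* Diagonal sequence: entry [i] is settled from stage [i.+1] on. *)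
exists (fun i => G i.+1 i) => k; apply: Pext (GP k) => i; exact: Gstable.
Qed.

Lemma regular_set_type {Z : topologicalType} (X : set Z) :
  regular_space Z -> regular_space X.
Proof.
move=> Z3 x U /nbhs_set_val[V Vx VU].
have [B [oB Bx clBV]] := nbhs_regular Z3 (open_nbhs_nbhs Vx).
exists (set_val @^-1` B).
  by apply/nbhs_set_val; exists B.
move=> y cly; apply/VU/clBV => N; rewrite nbhsE => -[N' N'y N'N].
have [|w [Bw Nw]] := cly (set_val @^-1` N').
  by apply/nbhs_set_val; exists N'.
by exists (set_val w); split=> //; exact: N'N.
Qed.

Section tree_construction.
Context {Y Z : topologicalType} {X : set Z} (f : X -> Y) (F : seq nat -> set Z).
Variable W : X -> nat -> set X.
Hypotheses (Yreg : regular_T1 Y) (Zreg : regular_T1 Z)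
  (Xpp : perfectly_paracompact X) (fD : Delta02_measurable f)
  (XF : X = \bigcup_(a in [set: nat -> nat]) \bigcap_n F (mkseq a n))
  (Wnbhs : forall x n, open_nbhs x (W x n))
  (npX : ~ piecewise_on f setT).

Local Notation tree_node := (tree_node f F W).
Local Notation node := (@node Y Z X).

Lemma parent_le k : parent k <= k.
Proof. by case: k => // k; exact/ltnW/parent_lt. Qed.

Lemma tree_node_ext g h k : (forall i, i <= k -> g i = h i) ->
  tree_node g k -> tree_node h k.
Proof.
move=> gh [tt tc tp tS tr tb tpS ta ti tcS tcp ts].
split; rewrite -?(gh k)// -?(gh (parent k)) ?parent_le//.
  by move=> i ik; rewrite -(gh i (ltnW ik)); exact: ta.
move=> k0 i /andP[i0 ik]; rewrite -(gh i (ltnW ik)) => pik.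
by apply: ts => //; rewrite i0.
Qed.

Definition targets (g : nat -> node) k := \bigcup_(j in `I_k) target (g j).

(** The second clause keeps the recursion going: every earlier node can still receive a child off
    all targets chosen so far. *)
Definition tree_upto k g :=
  (forall i, i < k -> tree_node g i) /\
  (forall i, i < k -> large f (targets g k) (piece (g i)) (node_point (g i))).

(** The region allowed for the new cell. It contains the parent's point, by [tree_cell_parent] for
    the earlier siblings. *)
Definition room (g : nat -> node) k := [set z | cell (g (parent k)) z /\
  forall i, i < k -> 0 < i -> parent i = parent k -> ~ closure (cell (g i)) z].

Lemma open_room g k : tree_upto k g -> 0 < k -> open (room g k).
Proof.
move=> [gT _] k0; rewrite openE => z [cz nz].
have [oc _] := tree_cell (gT _ (parent_lt k0)).
apply: filterI; first exact: open_nbhs_nbhs.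
apply: near_bounded_forall => i ik.
have [[i0 pik]|nik] := pselect (0 < i /\ parent i = parent k).
  apply: (@filterS _ _ _ (~` closure (cell (g i)))) => [//|].
  apply: open_nbhs_nbhs; split; last exact: nz.
  exact/closed_openC/closed_closure.
by apply: filterE => w i0 pik; case: nik.
Qed.

(** Largeness at the parent's point leaves a set outside the ideal in any small neighbourhood [B] of
    it, off the targets. A closed [H] makes its closure avoid the targets, and splitting by the next
    Souslin index yields [m]. *)
Lemma large_piece_exists g k : tree_upto k g -> exists A t,
  [/\ ~ piecewise_on f A, A `<=` souslin_part F t,
      closure A `<=` ~` (f @^-1` targets g k), k = 0 -> t = [::] &
      0 < k -> [/\ A `<=` piece (g (parent k)),
        exists m, t = rcons (node_code (g (parent k))) m,
        closure A `<=` W (node_point (g (parent k))) k &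
        closure A `<=` set_val @^-1` room g k]].
Proof.
case: k => [_|k' gk].
  exists setT, [::]; split=> //; first by rewrite (souslin_partT XF).
  by move=> x _ [].
move: (ltn0Sn k'); set k := k'.+1 in gk * => k0.
have [gT glarge] := gk; set p := parent k; have pk : p < k by exact: parent_lt.
have [oRoom roomp] : open_nbhs (set_val (node_point (g p))) (room g k).
  split; first exact: open_room.
  split; first by case: (tree_cell (gT p pk)).
  by move=> i ik i0 pik; move: (tree_cell_parent (gT i ik) i0); rewrite pik.
have [B [oB Bp clB]] : exists B, [/\ open B, B (node_point (g p)) &
    closure B `<=` W (node_point (g p)) k `&` set_val @^-1` room g k].
  apply: (nbhs_regular (regular_set_type Zreg.2)); apply: filterI.
    exact: open_nbhs_nbhs.
  by apply/nbhs_set_val; exists (room g k).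
have oO : open (targets g k).
  by apply: bigcup_open => j jk; case: (tree_target (gT j jk)).
have cO : closed (~` targets g k) by exact: open_closedC.
have [H [cH HO npH]] := piecewise_on_Fsigma
  (glarge p pk B (open_nbhs_nbhs (conj oB Bp))) (Fsigma_preimage_closed fD cO).
have [m npm] : exists m, ~ piecewise_on f (piece (g p) `&` B `&` H `&`
    souslin_part F (rcons (node_code (g p)) m)).
  apply: contrapT => /forallNP pm; apply: npH.
  apply: (@piecewise_onS _ _ _ _ (\bigcup_m (piece (g p) `&` B `&` H `&`
    souslin_part F (rcons (node_code (g p)) m)))).
    rewrite -setI_bigcupr -souslin_part_rcons => x [[px Bx] Hx].
    by do !split=> //; exact: (tree_piece (gT p pk)).
  by apply: piecewise_on_bigcup => m; exact: contrapT (pm m).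
exists (piece (g p) `&` B `&` H `&` souslin_part F (rcons (node_code (g p)) m)).
exists (rcons (node_code (g p)) m); split=> //.
- move=> x clx; have Hx : H x by apply: cH; apply: closureS clx => y [[]].
  exact: HO x Hx.
- move=> _; have clA : closure (piece (g p) `&` B `&` H `&`
    souslin_part F (rcons (node_code (g p)) m)) `<=` closure B.
    by apply: closureS => y [[[]]].
  split; [by move=> x [[[]]]|by exists m|by move=> x /clA/clB[]|].
  by move=> x /clA/clB[].
Qed.

Lemma tree_step k g : tree_upto k g ->
  exists x, tree_upto k.+1 (fun i => if i < k then g i else x).
Proof.
move=> gk; have [gT glarge] := gk.
have [A [t [npA At AO t0 Apar]]] := large_piece_exists gk.
have [x [U [clx Ux lU lA]]] := large_extend Xpp Yreg fD glarge npA
  (subset_trans (@subset_closure _ A) AO).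
have nOx : ~ targets g k (f x) by exact: AO.
(* [f x] misses the parent's target, so [x] differs from the parent's point, and regularity of [Z]
   keeps the new cell away from that point. *)
have [N Nx NP] : exists2 N, open_nbhs (set_val x) N & 0 < k ->
    closure N `<=` room g k `&` ~` [set set_val (node_point (g (parent k)))].
  have [k0|] := ltnP 0 k; last first.
    by exists setT => //; exact: open_nbhsT.
  have [_ _ _ clAroom] := Apar k0.
  have pk := parent_lt k0.
  have [|N [oN Nx clN]] := @nbhs_regular _ (set_val x) (room g k `&`
      ~` [set set_val (node_point (g (parent k)))]) Zreg.2.
    apply: open_nbhs_nbhs; split.
      apply: openI; first exact: open_room.
      exact/closed_openC/(accessible_closed_set1 Zreg.1).
    split; first exact: clAroom.
    move=> /= /val_inj xp; apply: nOx; exists (parent k) => //.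
    by rewrite xp; case: (tree_target (gT _ pk)).
  by exists N.
exists (Node x U A t N); set h := fun i => _.
have hk : h k = Node x U A t N by rewrite /h ltnn.
have hg i : i < k -> h i = g i by rewrite /h => ->.
have ht : targets h k.+1 = targets g k `|` U.
  rewrite /targets; apply/seteqP; split=> y.
    move=> [i /=]; rewrite ltnS leq_eqVlt => /predU1P[->|ik].
      by rewrite hk; right.
    by rewrite hg// => iy; left; exists i.
  move=> [[i /= ik iy]|Uy]; last by exists k => //=; rewrite hk.
  by exists i; rewrite /= ?hg// ltnW.
split=> i; rewrite ltnS leq_eqVlt => /predU1P[->|ik].
- split; rewrite ?hk//=.
  + move=> k0; rewrite hg ?parent_lt//.
    by have [_ _ clW _] := Apar k0; exact: clW.
  + by move=> k0; rewrite hg ?parent_lt//; have [] := Apar k0.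
  + move=> j jk y /AO nOy; rewrite hg// => jy; apply: nOy.
    by exists j.
  + by move=> k0; rewrite hg ?parent_lt//; have [] := Apar k0.
  + move=> k0; rewrite hg ?parent_lt// => z Nz.
    by have [[]] := NP k0 z (subset_closure Nz).
  + by move=> k0; rewrite hg ?parent_lt// => /(NP k0)[_]; exact.
  + move=> k0 j /andP[j0 jk] pjk; rewrite hg// -subset0 => z [jz Nz].
    have [[_ /(_ j jk j0 pjk) nz] _] := NP k0 z (subset_closure Nz).
    by apply: nz; exact: subset_closure.
- apply: tree_node_ext (gT i ik) => j ji; rewrite hg//.
  exact: leq_ltn_trans ji ik.
- by rewrite ht hk.
- by rewrite ht hg//; exact: lU.
Qed.

Lemma tree_exists : exists g, forall k, tree_node g k.
Proof.
(* A point of [X] for the dummy initial sequence, about which [tree_upto 0] says nothing. *)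
have [x _] := large_exists Xpp Yreg npX.
have [||k g|g gP] := @sequential_choice _ tree_upto
    (fun=> Node x setT setT [::] setT).
- move=> k g h gh [gT gl]; split=> i ik.
    apply: tree_node_ext (gT i ik) => j ji; apply: gh.
    exact: leq_ltn_trans ji ik.
  have -> : targets h k = targets g k.
    by apply: eq_bigcupr => j jk; rewrite gh.
  by rewrite -gh//; exact: gl.
- by split.
- exact: tree_step.
by exists g => k; exact: (gP k.+1).1.
Qed.

End tree_construction.

(** * The converse implication and the equivalence *)

Lemma piecewise_continuous_Delta02 {T Y : topologicalType} (f : T -> Y) :
  perfectly_paracompact T -> piecewise_continuous f -> Delta02_measurable f.
Proof.
move=> Tpp /piecewise_onT[D cD DT] V oV.
have preE (E : set Y) : f @^-1` E = \bigcup_n (D n `&` f @^-1` E).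
  rewrite -setI_bigcupl; apply/seteqP; split=> [x Ex|x []//].
  by split=> //; exact: DT.
split; last first.
  exists (fun n => ~` (D n `&` f @^-1` (~` V))) => [n|].
    exact/closed_openC/cD/open_closedC.
  by rewrite -setC_bigcup -preE preimage_setC setCK.
have cDn n : closed (D n) by rewrite -(setIT (D n)); exact: (cD n _ closedT).
(* Within [D n], the preimage of [V] is the complement of a closed set, and open sets are [Fsigma]
   because closed sets are [Gdelta]. *)
have [E cE VE] : exists2 E : nat -> nat -> set T, (forall n m, closed (E n m)) &
    forall n, D n `&` f @^-1` V = \bigcup_m (D n `&` E n m).
  suff /choice[E EP] : forall n, exists E : nat -> set T,
      (forall m, closed (E m)) /\ D n `&` f @^-1` V = \bigcup_m (D n `&` E m).
    by exists E => [n|n]; case: (EP n).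
  move=> n; have [E cE DE] : Fsigma (~` (D n `&` f @^-1` (~` V))).
    by apply: Fsigma_setC; rewrite setCK; apply/Tpp.2/cD/open_closedC.
  exists E; split => //; rewrite -setI_bigcupr -DE setCI preimage_setC setCK.
  by rewrite setIUr setICr set0U.
exists (fun k => if unpickle k is Some (n, m) then D n `&` E n m else set0).
  move=> k; case: (unpickle k) => [[n m]|]; last exact: closed0.
  exact: closedI.
rewrite preE; apply/seteqP; split=> x [].
  move=> n _; rewrite VE => -[m _ nmx]; exists (pickle (n, m)) => //.
  by rewrite pickleK.
move=> k _; case: (unpickle k) => // -[n m] nmx; exists n => //.
by rewrite VE; exists m.
Qed.

Theorem theorem2 (Y Z : topologicalType) (X : set Z)
  (Yreg : regular_T1 Y) (Zreg : regular_T1 Z) (ZcB : completely_baire Z)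
  (XS : souslinF X)
  (Xpp : perfectly_paracompact (set_type X))
  (Xfc : first_countable (set_type X))
  (f : set_type X -> Y) :
  Delta02_measurable f <-> piecewise_continuous f.
Proof.
split=> [fD|]; last exact: piecewise_continuous_Delta02.
apply/piecewise_onT; apply: contrapT => npX; have [F cF XF] := XS.
have /choice[W WP] : forall x : X, exists W : nat -> set X,
    (forall n, open_nbhs x (W n)) /\
    forall U, nbhs x U -> exists n, forall m, n <= m -> W m `<=` U.
  by move=> x; have [W] := decreasing_nbhs_base x Xfc; exists W.
have [g gT] := tree_exists Yreg Zreg Xpp fD XF (fun x => (WP x).1) npX.
by have := tree_absurd cF XF (fun x => (WP x).2) gT ZcB fD.
Qed.
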